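(* Let $d\ge 2$ and $h=0$. There exists $\lambda_c>0$ such that for all $\lambda\ge\lambda_c$ the hard-core Widom-Rowlinson model on $\mathbb Z^d$ has a phase transition, i.e. $|\mathcal G(\gamma^{hc}_{\lambda,0})|>1$.
   Context: Let $E=\{-1,0,1\}$ with the discrete topology and $\Omega=E^{\mathbb Z^d}$ with the product $\sigma$-algebra $\mathcal F$. For $\Lambda\subset\mathbb Z^d$ write $\Omega_\Lambda=E^\Lambda$, $\Lambda^c=\mathbb Z^d\setminus\Lambda$, and $\mathcal F_\Lambda$ for the $\sigma$-algebra generated by the coordinates in $\Lambda$. Write $i\sim j$ if $\|i-j\|_1=1$, and for finite $\Lambda$ let $\mathcal E^b_\Lambda=\{\{i,j\}\subset\mathbb Z^d: i\sim j,\ \{i,j\}\cap\Lambda\ne\emptyset\}$. A specification $\gamma=(\gamma_\Lambda)$, indexed by finite $\Lambda\subset\mathbb Z^d$, is a family of probability kernels from $\mathcal F_{\Lambda^c}$ to $\mathcal F$ with $\gamma_\Lambda(B|\cdot)=\mathbf 1_B$ for $B\in\mathcal F_{\Lambda^c}$ and $\gamma_\Lambda(\gamma_\Delta(A|\cdot)|\omega)=\gamma_\Lambda(A|\omega)$ for $\Delta\subset\Lambda$, $A\in\mathcal F$. A probability measure $\mu$ on $(\Omega,\mathcal F)$ is admitted by $\gamma$ if $\mu(A|\mathcal F_{\Lambda^c})=\gamma_\Lambda(A|\cdot)$ $\mu$-a.s. for all finite $\Lambda$ and $A\in\mathcal F$; $\mathcal G(\gamma)$ is the set of probability measures admitted by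 the (quasilocal) specification $\gamma$. For $\lambda>0$, $h\in\mathbb R$, the hard-core Widom-Rowlinson specification is, for finite $\Lambda$, $\omega\in\Omega_\Lambda$, $\eta\in\Omega_{\Lambda^c}$, $$\gamma^{hc}_{\Lambda,\lambda,h}(\omega|\eta)=\frac1{Z_\eta}\prod_{\{i,j\}\in\mathcal E^b_\Lambda}\mathbf 1(\xi_i\xi_j\ne-1)\,\exp\Big(\sum_{i\in\Lambda}\big(\log(\lambda)\,\xi_i^2+h\,\xi_i\big)\Big),\qquad \xi=\omega_\Lambda\eta_{\Lambda^c},$$ where $Z_\eta$ normalizes to a probability measure on $\Omega_\Lambda$ (extended to $\Omega$ by fixing the configuration $\eta$ off $\Lambda$). *)

(* Defs.v *)
From HB Require Import structures.
From mathcomp Require Import all_boot all_order all_algebra finmap.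
From mathcomp Require Import all_classical all_reals all_analysis.
From mathcomp Require Import measurable_realfun zify ring lra.

Set Implicit Arguments.
Unset Strict Implicit.
Unset Printing Implicit Defensive.

Import Order.TTheory GRing.Theory Num.Theory.
Import numFieldNormedType.Exports.

Local Open Scope classical_set_scope.
Local Open Scope ring_scope.

Definition spin := seq_sub [:: -1; 0; 1 : int].

HB.instance Definition _ := Finite.on spin.

Definition spin0 : spin := @SeqSub _ [:: -1; 0; 1 : int] 0 isT.

HB.instance Definition _ := isPointed.Build spin spin0.

Notation site d := 'rV[int]_d.

Definition adj d (i j : site d) : bool := \sum_k `|i 0 k - j 0 k| == 1.

Definition config (d : nat) := site d -> spin.

HB.instance Definition _ d := Pointed.copy (config d) (site d -> spin).

Definition cylinders d (V : set (site d)) : set (set (config d)) :=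
  [set [set w : config d | B (w i)] | i in V & B in [set: set spin]].

(* Configurations on the whole of Z^d, with the sigma-algebra F_V generated by
   the coordinates in V only. *)
Definition configOn d (V : set (site d)) := g_sigma_algebraType (cylinders V).

Notation configT d := (configOn [set: site d]).
Notation configC L := (configOn (~` [set` L])).

Section Specification.
Context (R : realType) (d : nat).
Local Open Scope ereal_scope.

Record specification := Specification {
  spec_kernel :> forall L : {fset site d}, R.-pker (configC L) ~> (configT d);
  spec_proper : forall (L : {fset site d}) (B : set (config d)) (w : config d),
    measurable (B : set (configC L)) -> spec_kernel L w B = (\1_B w)%:E;
  spec_consistent : forall (D L : {fset site d}) (A : set (config d))
      (w : config d),
    (D `<=` L)%fset -> measurable (A : set (configT d)) ->
    \int[spec_kernel L w]_x spec_kernel D x A = spec_kernel L w A }.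

(* f is a version of the conditional probability mu(A | F_V). *)
Definition is_cond_prob (mu : probability (configT d) R) (V : set (site d))
    (A : set (config d)) (f : config d -> \bar R) : Prop :=
  [/\ measurable_fun [set: configOn V] (f : configOn V -> \bar R),
      mu.-integrable [set: configT d] f
    & forall B : set (config d), measurable (B : set (configOn V)) ->
        \int[mu]_(w in B) f w = mu (A `&` B)].

Definition admitted (gamma : specification) (mu : probability (configT d) R) :
    Prop :=
  forall (L : {fset site d}) (A : set (config d)),
    measurable (A : set (configT d)) ->
    exists2 f, is_cond_prob mu (~` [set` L]) A f &
      {ae mu, forall w, f w = gamma L w A}.

Definition Gibbs (gamma : specification) : set (probability (configT d) R) :=
  [set mu | admitted gamma mu].

(* |Gibbs gamma| > 1. Measures are functions on all sets, so two probability
   measures count as distinct only if they differ on a measurable set. *)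
Definition phase_transition (gamma : specification) : Prop :=
  exists mu nu, [/\ Gibbs gamma mu, Gibbs gamma nu &
    exists2 A : set (configT d), measurable A & mu A <> nu A].

End Specification.

Section Glue.
Context (d : nat).
Implicit Types (L D : {fset site d}) (eta xi : config d).

Definition glue L (w : {ffun L -> spin}) eta : config d :=
  fun i => if insub i is Some k then w k else eta i.

Definition restr L xi : {ffun L -> spin} := [ffun k => xi (val k)].

Lemma glue_in L (w : {ffun L -> spin}) eta (k : L) : glue w eta (val k) = w k.
Proof. by rewrite /glue valK. Qed.

Lemma glue_inE L (w : {ffun L -> spin}) eta i (iL : i \in L) :
  glue w eta i = w (FSetSub iL).
Proof. exact: (glue_in w eta (FSetSub iL)). Qed.

Lemma glue_out L (w : {ffun L -> spin}) eta i :
  i \notin L -> glue w eta i = eta i.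
Proof. by move=> iL; rewrite /glue insubN. Qed.

Lemma glue_restr L xi eta : (forall i, i \notin L -> xi i = eta i) ->
  glue (restr L xi) eta = xi.
Proof.
move=> h; apply/funext => i; have [iL|iL] := boolP (i \in L).
  by rewrite (glue_inE _ _ iL) ffunE.
by rewrite glue_out// h.
Qed.

Lemma restr_glue L (w : {ffun L -> spin}) eta : restr L (glue w eta) = w.
Proof. by apply/ffunP => k; rewrite ffunE glue_in. Qed.

Lemma eq_glue L (w : {ffun L -> spin}) eta eta' :
  (forall i, i \notin L -> eta i = eta' i) -> glue w eta = glue w eta'.
Proof.
move=> h; apply/funext => i; have [iL|iL] := boolP (i \in L).
  by rewrite !(glue_inE _ _ iL).
by rewrite !glue_out// h.
Qed.

End Glue.

Section WidomRowlinson.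
Context (R : realType) (d : nat) (lambda h : R).
Implicit Types (L D : {fset site d}) (eta xi : config d).

(* Unordered nearest-neighbour pairs meeting L; a finite set by finite_bdedges
   below, so that the product over it in hc_weight is a genuine one. *)
Definition bdedges L : set {fset site d} :=
  [set [fset p.1; p.2]%fset |
     p in [set p : site d * site d | adj p.1 p.2 && ((p.1 \in L) || (p.2 \in L))]].

(* The constraint xi_i xi_j <> -1 on the unordered pair e = {i, j}. *)
Definition hardcore xi (e : {fset site d}) : bool :=
  `[< forall i j, e = [fset i; j]%fset -> \val (xi i) * \val (xi j) != -1 >].

Definition hc_weight L xi : R :=
  (\big[*%R/(1 : R)]_(e \in bdedges L) (hardcore xi e)%:R) *
  expR (\sum_(i <- L) (ln lambda * (\val (xi i))%:~R ^+ 2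
                       + h * (\val (xi i))%:~R)).

Definition hc_Z L eta : R := \sum_(w : {ffun L -> spin}) hc_weight L (glue w eta).

Definition hc_prob L eta (w : {ffun L -> spin}) : R :=
  hc_weight L (glue w eta) / hc_Z L eta.

(* The finite-volume measure on E^L, transported to the full configuration
   space by fixing eta outside L. *)
Definition hc_measure L eta (A : set (configT d)) : \bar R :=
  (\sum_(w : {ffun L -> spin}) hc_prob eta w * \1_A (glue w eta))%:E.

Lemma measurable_fin dT (T : measurableType dT) (V : set (site d))
    (N : {fset site d}) (f : configOn V -> T) : [set` N] `<=` V ->
  (forall xi eta, (forall i, i \in N -> xi i = eta i) -> f xi = f eta) ->
  measurable_fun [set: configOn V] f.
Proof.
move=> NV fN _ Y mY; rewrite setTI.
rewrite (_ : f @^-1` Y =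
  \bigcup_(w in [set w : {ffun N -> spin} | Y (f (glue w (fun=> spin0)))])
    \bigcap_(k in [set: N]) [set xi : config d | [set w k] (xi (val k))]).
  apply: fin_bigcup_measurable => [|w _]; first exact: finite_finset.
  apply: fin_bigcap_measurable => [|k _]; first exact: finite_finset.
  apply: sub_sigma_algebra; exists (val k); first by apply: NV => /=; exact: valP.
  by exists [set w k].
apply/seteqP; split=> [xi Yxi|xi [w Yw xiw]] /=.
  exists (restr N xi) => /=.
    rewrite (fN _ xi) // => i iN.
    by rewrite (glue_inE _ _ iN) ffunE.
  by move=> k _ /=; rewrite ffunE.
rewrite (fN _ (glue w (fun=> spin0))) // => i iN.
by rewrite (glue_inE _ _ iN); exact: (xiw (FSetSub iN) Logic.I).
Qed.

Lemma measurable_configOn (V : set (site d)) (B : set (config d)) :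
  measurable (B : set (configOn V)) -> measurable (B : set (configT d)).
Proof.
move=> mB; suff : <<s cylinders V >> `<=` <<s cylinders setT >> by exact.
apply: sub_sigma_algebra2 => _ [i _ [C _ <-]].
by exists i => //; exists C.
Qed.

Lemma measurable_glue L (w : {ffun L -> spin}) :
  measurable_fun [set: configC L] (glue w : configC L -> configT d).
Proof.
apply: (@measurability _ _ (configC L) (configT d) _ _ (cylinders setT)) => //.
move=> _ [_ [i _ [B _ <-]] <-]; rewrite setTI.
have [iL|iL] := boolP (i \in L).
  rewrite [X in measurable X](_ : _ =
    if `[< B (w (FSetSub iL)) >] then setT else set0).
    by case: ifP => _; [exact: measurableT|exact: measurable0].
  by apply/seteqP; split => xi /=; rewrite glue_inE; case: asboolP.
apply: sub_sigma_algebra; exists i; first by move=> /= iL'; rewrite iL' in iL.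
by exists B => //; apply/seteqP; split=> xi /=; rewrite glue_out.
Qed.

Lemma finite_adj (i : site d) : finite_set [set j | adj i j].
Proof.
pose F (f : {ffun 'I_d -> 'I_3}) : site d :=
  \row_k (i 0 k + 1 - (f k : nat)%:Z).
apply: (@sub_finite_set _ _ (F @` setT)); last first.
  by apply: finite_image; exact: finite_finset.
move=> j /= /eqP ij.
have le1 k : `|i 0 k - j 0 k| <= 1.
  by rewrite -ij (bigD1 k) //= lerDl sumr_ge0.
exists [ffun k : 'I_d => inord `|(i 0 k - j 0 k + 1)%R|%N] => //.
apply/rowP => k; rewrite mxE ffunE inordK; last by have := le1 k; lia.
by have := le1 k; lia.
Qed.

Lemma finite_bdedges L : finite_set (bdedges L).
Proof.
apply: (@sub_finite_set _ _
  ([set [fset p.1; p.2]%fset |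
     p in \bigcup_(i in [set` L]) ([set i] `*` [set j | adj i j])])).
  move=> _ [[i j] /= /andP[ij /orP[iL|jL]] <-].
    by exists (i, j) => //=; exists i.
  exists (j, i); last by rewrite fsetUC.
  exists j => //=; split=> //=.
  by move: ij; rewrite /adj; under eq_bigr do rewrite distrC.
apply: finite_image; apply: bigcup_finite; first exact: finite_fset.
by move=> i _; apply: finite_setX; [exact: finite_set1|exact: finite_adj].
Qed.

Lemma hardcore_ext xi eta (e : {fset site d}) :
  (forall i, i \in e -> xi i = eta i) -> hardcore xi e = hardcore eta e.
Proof.
move=> xe; apply/asboolP/asboolP => H i j ee; have := H _ _ ee;
  by rewrite !xe ?ee ?inE ?eqxx ?orbT.
Qed.

Lemma hc_weightE L xi : hc_weight L xi =
  (\prod_(e <- fset_set (bdedges L)) (hardcore xi e)%:R) *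
  expR (\sum_(i <- L) (ln lambda * (\val (xi i))%:~R ^+ 2
                       + h * (\val (xi i))%:~R)).
Proof. by rewrite /hc_weight fsbig_finite//; exact: finite_bdedges. Qed.

Lemma hc_weight_ge0 L xi : 0 <= hc_weight L xi.
Proof.
by rewrite hc_weightE mulr_ge0 ?expR_ge0// prodr_ge0.
Qed.

Lemma hc_Z_gt0 L eta : 0 < hc_Z L eta.
Proof.
pose w0 : {ffun L -> spin} := [ffun=> spin0].
rewrite /hc_Z (bigD1 w0) //= ltr_wpDr//.
  by apply: sumr_ge0 => w _; exact: hc_weight_ge0.
rewrite hc_weightE big_seq big1 ?mul1r ?expR_gt0// => e.
rewrite in_fset_set ?inE; last exact: finite_bdedges.
move=> [[i j] /= /andP[_ ijL] <-].
suff -> : hardcore (glue w0 eta) [fset i; j]%fset by [].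
have g0 k : k \in L -> \val (glue w0 eta k) = 0.
  by move=> kL; rewrite (glue_inE _ _ kL) ffunE.
apply/asboolP => a b /fsetP ab.
have := ab i; have := ab j; rewrite !inE !eqxx orbT /= => /esym jab /esym iab.
case/orP: ijL => /g0.
  by case/orP: iab => /eqP <- ->; rewrite ?mul0r ?mulr0.
by case/orP: jab => /eqP <- ->; rewrite ?mul0r ?mulr0.
Qed.

Lemma hc_Z_neq0 L eta : hc_Z L eta != 0.
Proof. by rewrite gt_eqF// hc_Z_gt0. Qed.

Lemma hc_prob_ge0 L eta (w : {ffun L -> spin}) : 0 <= hc_prob eta w.
Proof. by rewrite divr_ge0 ?hc_weight_ge0// ltW// hc_Z_gt0. Qed.

Lemma hc_prob_sum L eta : \sum_(w : {ffun L -> spin}) hc_prob eta w = 1.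
Proof. by rewrite -mulr_suml divff// hc_Z_neq0. Qed.

Lemma eq_hc_Z L eta eta' :
  (forall i, i \notin L -> eta i = eta' i) -> hc_Z L eta = hc_Z L eta'.
Proof. by move=> h'; apply: eq_bigr => w _; rewrite (eq_glue w h'). Qed.

Definition hc_support L : {fset site d} :=
  (L `|` \bigcup_(e <- fset_set (bdedges L)) e)%fset.

Lemma hc_weight_ext L xi eta : (forall i, i \in hc_support L -> xi i = eta i) ->
  hc_weight L xi = hc_weight L eta.
Proof.
move=> xe; rewrite !hc_weightE; congr (_ * expR _).
  rewrite !big_seq; apply: eq_bigr => e eL; rewrite (hardcore_ext (eta := eta))//.
  move=> i ie; apply: xe; rewrite inE; apply/orP; right.
  by apply/bigfcupP; exists e; rewrite ?eL.
rewrite !big_seq; apply: eq_bigr => i iL.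
by rewrite xe// inE iL.
Qed.

Lemma measurable_hc_prob L (w : {ffun L -> spin}) :
  measurable_fun [set: configC L] (fun eta : configC L => hc_prob eta w).
Proof.
apply: (@measurable_fin _ _ _ (hc_support L `\` L)%fset).
  by move=> i /=; rewrite inE => /andP[/negP].
move=> xi eta xe.
have g (v : {ffun L -> spin}) :
    hc_weight L (glue v xi) = hc_weight L (glue v eta).
  apply: hc_weight_ext => i iN; have [iL|iL] := boolP (i \in L).
    by rewrite !(glue_inE _ _ iL).
  by rewrite !glue_out// xe// inE iL.
by rewrite /hc_prob /hc_Z g; under eq_bigr do rewrite g.
Qed.

Lemma hc_weight_swap D L xi eta : (D `<=` L)%fset ->
  (forall i, i \notin D -> xi i = eta i) ->
  hc_weight L xi * hc_weight D eta = hc_weight L eta * hc_weight D xi.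
Proof.
move=> DL xe.
pose rest xi := \big[*%R/(1 : R)]_(e \in bdedges L `&` ~` bdedges D) (hardcore xi e)%:R
  * expR (\sum_(i <- (L `\` D)%fset) (ln lambda * (\val (xi i))%:~R ^+ 2
                       + h * (\val (xi i))%:~R)) : R.
have H (z : config d) : hc_weight L z = hc_weight D z * rest z.
  rewrite /hc_weight (fsbigID (bdedges D)) /=; last exact: finite_bdedges.
  rewrite (_ : bdedges L `&` bdedges D = bdedges D); last first.
    apply/setIidPr => _ [[i j] /= /andP[ij iD] <-]; exists (i, j) => //=.
    by rewrite ij /=; case/orP: iD => /(fsubsetP DL) ->; rewrite ?orbT.
  rewrite /rest mulrACA -expRD; congr (_ * expR _).
  rewrite (big_fsetID _ (mem D)) /=; congr (_ + _).
    apply: eq_fbigl => i; rewrite !inE /= andb_idl//.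
    by move/fsubsetP : DL; exact.
  by apply: eq_fbigl => i; rewrite !inE /= andbC.
have Hr : rest xi = rest eta.
  rewrite /rest; congr (_ * expR _); last first.
    by rewrite !big_seq; apply: eq_bigr => i; rewrite inE => /andP[iD _]; rewrite xe.
  apply: eq_fsbigr => e /[!inE] -[[[i j] /= /andP[ij ijL] <-]] eD.
  rewrite (hardcore_ext (eta := eta))// => k kij; apply: xe.
  apply/negP => kD; apply: eD; exists (i, j) => //=; rewrite ij /=.
  by move: kij; rewrite !inE => /orP[] /eqP <-; rewrite kD ?orbT.
by rewrite !H Hr; ring.
Qed.

Section HcMeasure.
Variables (L : {fset site d}) (eta : config d).

Let m_ (n : nat) : {measure set (configT d) -> \bar R} :=
  let w := nth [ffun=> spin0] (enum {ffun L -> spin}) n in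
  mscale (NngNum (hc_prob_ge0 eta w)) (dirac (glue w eta : configT d)).

Let hc_measureE :
  hc_measure L eta = msum m_ (size (enum {ffun L -> spin})).
Proof.
apply/funext => A; rewrite /hc_measure /msum /= -sumEFin -big_enum /=.
by rewrite (big_nth [ffun=> spin0]) big_mkord.
Qed.

Let hc_measure0 : hc_measure L eta set0 = 0%E.
Proof. by rewrite hc_measureE measure0. Qed.

Let hc_measure_ge0 A : (0 <= hc_measure L eta A)%E.
Proof. by rewrite hc_measureE. Qed.

Let hc_measure_sigma_additive : semi_sigma_additive (hc_measure L eta).
Proof. by rewrite hc_measureE; exact: measure_semi_sigma_additive. Qed.

HB.instance Definition _ := isMeasure.Build _ _ _ (hc_measure L eta)
  hc_measure0 hc_measure_ge0 hc_measure_sigma_additive.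

Lemma hc_integral (f : configT d -> \bar R) :
  measurable_fun setT f -> (forall x, 0 <= f x)%E ->
  (\int[hc_measure L eta]_x f x =
   \sum_(w : {ffun L -> spin}) (hc_prob eta w)%:E * f (glue w eta))%E.
Proof.
move=> mf f0.
rewrite (eq_measure_integral (msum m_ (size (enum {ffun L -> spin})))); last first.
  by move=> A _ _; exact: (congr1 (fun m => m A) hc_measureE).
rewrite ge0_integral_measure_sum// -[RHS]big_enum /=.
rewrite [RHS](big_nth [ffun=> spin0]) big_mkord.
apply: eq_bigr => i _; rewrite ge0_integral_mscale// integral_dirac//.
by rewrite diracT mul1e.
Qed.

End HcMeasure.

Definition hc_kernel L : configC L -> {measure set (configT d) -> \bar R} :=
  hc_measure L.

Section HcKernel.
Variable L : {fset site d}.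

Let measurable_hc_kernel U : measurable U ->
  measurable_fun [set: configC L] (@hc_kernel L ^~ U).
Proof.
move=> mU; apply/measurable_EFinP; apply: measurable_sum => w.
apply: measurable_funM; first exact: measurable_hc_prob.
by apply: measurableT_comp (measurable_glue w); exact: measurable_indic.
Qed.

HB.instance Definition _ := isKernel.Build _ _ (configC L) (configT d) R
  (@hc_kernel L) measurable_hc_kernel.

Let hc_kernelT eta : @hc_kernel L eta setT = 1%E.
Proof.
rewrite /= /hc_measure; under eq_bigr do rewrite indicT mulr1.
by rewrite hc_prob_sum.
Qed.

HB.instance Definition _ := Kernel_isProbability.Build _ _ (configC L)
  (configT d) R (@hc_kernel L) hc_kernelT.

End HcKernel.

Lemma measurable_outside L (B : set (config d)) (xi eta : config d) :
  measurable (B : set (configC L)) ->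
  (forall i, i \notin L -> xi i = eta i) -> B xi <-> B eta.
Proof.
move=> mB; move: B mB xi eta.
pose P (B : set (config d)) := forall xi eta : config d,
  (forall i, i \notin L -> xi i = eta i) -> B xi <-> B eta.
suff : <<s cylinders (~` [set` L]) >> `<=` P by [].
apply: smallest_sub; last first.
  move=> _ [i iL [B _ <-]] xi eta xe /=.
  by rewrite xe//; apply/negP.
split=> //.
- by move=> A PA xi eta xe; rewrite setTD /=; have := PA _ _ xe; tauto.
- move=> F PF xi eta xe; split=> -[n _ Fn]; exists n => //.
    exact/(PF n _ _ xe).
  exact/(PF n _ _ xe).
Qed.

Lemma hc_proper L (B : set (config d)) (eta : config d) :
  measurable (B : set (configC L)) -> hc_kernel (L := L) eta B = (\1_B eta)%:E.
Proof.
move=> mB; rewrite /= /hc_measure.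
have H (w : {ffun L -> spin}) : \1_B (glue w eta) = \1_B eta :> R.
  rewrite !indicE; congr (_%:R); congr nat_of_bool.
  have h' : B (glue w eta) <-> B eta.
    by apply: (measurable_outside mB) => i iL; rewrite glue_out.
  by apply/idP/idP; rewrite !inE => /h'.
by under eq_bigr do rewrite H; rewrite -mulr_suml hc_prob_sum mul1r.
Qed.

Lemma hc_consistent D L (A : set (config d)) (eta : config d) :
  (D `<=` L)%fset -> measurable (A : set (configT d)) ->
  (\int[hc_kernel (L := L) eta]_x hc_kernel (L := D) x A
   = hc_kernel (L := L) eta A)%E.
Proof.
move=> DL mA.
have mk : measurable_fun [set: configT d]
    (fun x : configT d => hc_kernel (L := D) x A).
  apply/measurable_EFinP; apply: measurable_sum => w.
  apply: measurable_funM.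
    apply: (@measurable_fin _ _ _ (hc_support D)) => // xi xi' xe.
    have g (v : {ffun D -> spin}) :
        hc_weight D (glue v xi) = hc_weight D (glue v xi').
      apply: hc_weight_ext => i iN; have [iD|iD] := boolP (i \in D).
        by rewrite !(glue_inE _ _ iD).
      by rewrite !glue_out// xe.
    by rewrite /hc_prob /hc_Z g; under eq_bigr do rewrite g.
  have mg : measurable_fun [set: configT d] (glue w : configT d -> configT d).
    move=> _ Y mY; rewrite setTI; apply: (@measurable_configOn (~` [set` D])).
    by rewrite -[X in measurable X]setTI; apply: measurable_glue.
  have mi : measurable_fun [set: configT d] (\1_A : configT d -> R).
    exact: measurable_indic.
  exact: measurableT_comp mi mg.
rewrite hc_integral//; under eq_bigr do rewrite -EFinM.
rewrite sumEFin; congr EFin.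
pose G (w : {ffun L -> spin}) : config d := glue w eta.
have GD (w : {ffun L -> spin}) (v : {ffun D -> spin}) :
    G (restr L (glue v (G w))) = glue v (G w).
  apply: glue_restr => i iL; rewrite glue_out; last first.
    by apply: contraNN iL; exact: (fsubsetP DL).
  by rewrite /G glue_out.
pose sw (p : {ffun L -> spin} * {ffun D -> spin}) :=
  (restr L (glue p.2 (G p.1)), restr D (G p.1)).
have swK : involutive sw.
  move=> [w v]; rewrite /sw /= GD restr_glue; congr pair.
  by rewrite (@glue_restr _ D (G w)) ?restr_glue// => i iD; rewrite glue_out.
pose T (p : {ffun L -> spin} * {ffun D -> spin}) : R :=
  hc_prob eta p.1 * (hc_prob (G p.1) p.2 * \1_A (glue p.2 (G p.1))).
transitivity (\sum_p T p).
  rewrite -(pair_bigA _ (fun w v => T (w, v))) /=; apply: eq_bigr => w _.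
  by rewrite mulr_sumr.
rewrite (reindex_inj (inv_inj swK)) /=.
transitivity (\sum_(w : {ffun L -> spin}) \sum_(v : {ffun D -> spin})
    hc_prob eta w * (hc_prob (G w) v * \1_A (G w))).
  rewrite pair_bigA /=; apply: eq_bigr => -[w v] _.
  have out i : i \notin D -> G w i = glue v (G w) i by move=> iD; rewrite glue_out.
  rewrite /T /sw /= GD (@glue_restr _ D (G w))//.
  rewrite /hc_prob -/(G _) GD -/(G _) (@glue_restr _ D (G w))//.
  rewrite -(eq_hc_Z out) -/(G w).
  have := hc_weight_swap DL out.
  move: (hc_weight L (G w)) (hc_weight D (glue v (G w))).
  move: (hc_weight L (glue v (G w))) (hc_weight D (G w)) => a b c e E.
  rewrite !mulrA; congr (_ * _).
  transitivity ((a * b) / hc_Z L eta / hc_Z D (G w)); first by ring.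
  by rewrite -E; ring.
apply: eq_bigr => w _; rewrite -mulr_sumr -mulr_suml hc_prob_sum mul1r//.
Qed.

Definition hc_spec : specification R d :=
  @Specification R d (fun L => @hc_kernel L) hc_proper hc_consistent.

End WidomRowlinson.

Arguments hc_spec {R} d lambda h.

(* Main.v *)
From HB Require Import structures.
Require Import Defs.
From mathcomp Require Import all_boot all_order all_algebra finmap.
From mathcomp Require Import all_classical all_reals all_analysis.
From mathcomp Require Import measurable_realfun zify ring lra.
(* The gluing of configurations must take precedence over the gluing of
   functions of the same name. *)
Import Defs.

Set Implicit Arguments.
Unset Strict Implicit.
Unset Printing Implicit Defensive.

(** A spin s <> 0 imposed outside a finite volume L survives at the origin,
    uniformly in L, once lambda is large; limits of the two finite-volume
    measures with constant boundary spins +1 and -1 are then two different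
    Gibbs measures.

    The energy estimate ([hc_pr_zero]) is that under the boundary condition s
    the spins vanish on a given finite set S with probability at most
    eps ^ |S|, where eps = 3 ^ (3 ^ d) / lambda. Given a configuration that is
    zero on S, fill S with s and recolour with s every occupied cluster next to
    S. The hard-core constraint is preserved, because a cluster is
    monochromatic and clusters are separated by zeros, and the weight grows by
    lambda ^ |S|. The original is recovered from the new configuration together
    with the spins in the neighbourhood of S, which have at most
    3 ^ (3 ^ d * |S|) values. No contour geometry is involved, as S is
    arbitrary.

    The geometric input is planar ([quadrant_circuit]): a finite set of sites
    of a quadrant containing the corner has outer boundary sites forming a
    chain of king moves from one axis to the other. It follows from Stokes'
    theorem modulo 2 on a large square: boundary edges meet each plaquette an
    even number of times, and so do those of a union of king-connected pieces
    of the boundary; if the pieces that meet the first axis missed the second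
    axis, the parity along the sides of the square would be wrong. It is applied
    to the sites of spin -s in a quadrant of a coordinate plane of Z^d, whose
    outer boundary sites are zeros. A chain starting at (k, 0) has more than k
    sites, there are at most 9 ^ k king walks of k steps, hence
    ([hc_pr_wrong_spin])
      P (sigma_0 <> s) <= sum_k 9 ^ k * eps ^ (k + 1) <= 1 / 3.

    The limit is taken along an ultrafilter of volumes, so that it exists for
    all events at once and is a finitely additive probability.
    Compactness of the configuration space makes it countably additive on local
    events, and Caratheodory's theorem extends it ([mean_extension]). The
    finite-volume consistency relations only involve local events and pass to
    the limit ([thermodynamic_limit]); by uniqueness of measures they hold for
    all events, which with the properness of the specification gives the
    conditional probabilities ([admitted_local]). *)

(** * Boundaries of finite sets in a quadrant *)

(** The truncated predecessor repeats a site on the axes, which only adds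
    repetitions to the enumerations of walks. *)
Definition king_nbrs (x : nat * nat) : seq (nat * nat) :=
  [seq (i, j) | i <- [:: x.1.-1; x.1; x.1.+1], j <- [:: x.2.-1; x.2; x.2.+1]].

Lemma king_step_col_le x y : y \in king_nbrs x -> x.1 <= y.1.+1.
Proof.
case: x => a b /allpairsPdep[u [v [uH _ ->]]] /=.
by move: uH; rewrite !inE => /or3P[] /eqP -> /=; lia.
Qed.

Lemma king_path_col x p :
  path (fun x y => y \in king_nbrs x) x p -> x.1 <= (last x p).1 + size p.
Proof.
elim: p x => [|y p IH] x /=; first by lia.
move=> /andP[/king_step_col_le xy /IH yp]; apply: leq_trans xy _.
by rewrite addnS ltnS.
Qed.

(** Stokes' theorem modulo 2: if the 1-chain with horizontal edges [h] and
    vertical edges [v] meets every plaquette evenly, then the parities of [h]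
    on two consecutive rows differ by the values of [v] at the ends of the
    strip between them. *)
Lemma square_stokes (h v : nat -> nat -> bool) N :
  (forall i j, i < N -> j < N ->
    h i j (+) h i j.+1 (+) (v i j (+) v i.+1 j) = false) ->
  (forall i, i < N -> h i N = false) ->
  (forall j, j < N -> v 0 j = false /\ v N j = false) ->
  \big[addb/false]_(i < N) h i 0 = false.
Proof.
move=> hv hN v0N.
pose B j := \big[addb/false]_(i < N) h i j.
have xor0 b c : b (+) c = false -> b = c by case: b c => [] [].
have tele j n : \big[addb/false]_(i < n) (v i j (+) v i.+1 j) = v 0 j (+) v n j.
  elim: n => [|n IHn]; first by rewrite big_ord0 addbb.
  by rewrite big_ord_recr /= IHn addbA addbK.
have BS j : j < N -> B j = B j.+1.
  move=> jN; apply: (xor0 _ _); rewrite -big_split /=.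
  transitivity (\big[addb/false]_(i < N) (v i j (+) v i.+1 j)).
    apply: eq_bigr => i _; exact/xor0/hv.
  by rewrite tele; have [-> ->] := v0N j jN.
have BN : B N = false by rewrite /B big1 // => i _; exact: hN.
rewrite -/(B 0) -BN.
have : forall n, n <= N -> B (N - n) = B N.
  elim=> [|n IHn] nN; first by rewrite subn0.
  by rewrite BS; [rewrite -subSn // subSS IHn //; lia|lia].
by move/(_ N (leqnn N)); rewrite subnn.
Qed.

(** The indicator of an edge between a site in the region [m] and a site in a
    part [g] of its outer boundary is the coboundary of [m], as soon as [g]
    contains whichever end of the edge is outside [m] while the other one is
    inside. *)
Lemma boundary_edgeE (mx my gx gy : bool) :
  (mx -> my || gy) -> (gx -> mx = false) -> (gy -> my = false) ->
  (my -> mx || gx) -> mx && gy || gx && my = mx (+) my.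
Proof.
case: mx my gx gy => -[] [] [] //= H1 H2 H3 H4;
  do ?[by have := H1 isT | by have := H2 isT
      | by have := H3 isT | by have := H4 isT].
Qed.

(** Here [m] is the finite region and [z] contains its outer boundary. The walk
    is cut after [k] steps, just enough for it to be able to reach the vertical
    axis: this makes its length a function of its starting point, which is what
    a union bound needs. *)
Lemma quadrant_circuit (m z : nat -> nat -> bool) N :
  m 0 0 -> (forall i j, m i j -> (i < N) && (j < N)) ->
  (forall i j, z i j -> ~~ m i j) ->
  (forall i j, m i j -> m i.+1 j || z i.+1 j) ->
  (forall i j, m i.+1 j -> m i j || z i j) ->
  (forall i j, m i j -> m i j.+1 || z i j.+1) ->
  (forall i j, m i j.+1 -> m i j || z i j) ->
  exists k (p : seq (nat * nat)),
    [/\ (k <= N) && (size p == k), path (fun x y => y \in king_nbrs x) (k, 0) p,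
        uniq ((k, 0) :: p) & all (fun x => z x.1 x.2) ((k, 0) :: p)].
Proof.
move=> m00 mN zm hR hL vU vD.
pose T := ('I_N.+1 * 'I_N.+1)%type.
pose pt (x : T) : nat * nat := (x.1 : nat, x.2 : nat).
pose zz (x : nat * nat) := z x.1 x.2.
pose e (x y : T) := [&& pt y \in king_nbrs (pt x), zz (pt x) & zz (pt y)].
pose at_ i j : T := (inord i, inord j).
have ptE i j : i <= N -> j <= N -> pt (at_ i j) = (i, j).
  by move=> iN jN; rewrite /pt /at_ /= !inordK.
(* The outer boundary sites king-connected to the horizontal axis. *)
pose g i j := [&& i <= N, j <= N, z i j &
  [exists k : 'I_N.+1, z k 0 && connect e (at_ k 0) (at_ i j)]].
have gz i j : g i j -> z i j by case/and4P.
have gK i j i' j' : (i', j') \in king_nbrs (i, j) -> i' <= N -> j' <= N ->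
    g i j -> z i' j' -> g i' j'.
  move=> kk iN' jN' /and4P[iN jN zij /existsP[k /andP[zk ck]]] zij'.
  apply/and4P; split=> //; apply/existsP; exists k; rewrite zk /=.
  by apply: connect_trans ck (connect1 _); rewrite /e !ptE // kk /zz /= zij.
have [[j gj]|g0] : (exists j, g 0 j) \/ (forall j, g 0 j = false).
  have [/existsP[j gj]|/existsPn g0] := boolP [exists j : 'I_N.+1, g 0 j].
    by left; exists j.
  right=> j; apply/negP => gj; have /and4P[_ jN _ _] := gj.
  by have := g0 (inord j); rewrite inordK ?gj.
- have /and4P[_ jN z0j /existsP[k /andP[zk /connectP[p ep lp]]]] := gj.
  case/shortenP: ep lp => q eq uq _ lq.
  have pq : path (fun x y => y \in king_nbrs x) (pt (at_ k 0)) (map pt q).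
    by rewrite path_map; apply: sub_path eq => x y /and3P[].
  have zq : all zz (pt (at_ k 0) :: map pt q).
    rewrite /= ptE ?leq_ord // {1}/zz /= zk /= all_map.
    move: eq; move: (at_ k 0) => x; elim: (q) x => //= y r IH x.
    by move=> /andP[/and3P[_ _ ->] /IH].
  have pt_inj : injective pt.
    by move=> [a b] [a' b'] [] /val_inj -> /val_inj ->.
  have uqn : uniq (pt (at_ k 0) :: map pt q).
    by rewrite -[_ :: _]/(map pt (at_ k 0 :: q)) map_inj_uniq.
  have lqn : last (pt (at_ k 0)) (map pt q) = (0, j).
    by rewrite last_map -lq ptE.
  move: pq zq uqn lqn; rewrite ptE ?leq_ord // => pq zq uqn lqn.
  have ks : k <= size (map pt q) by have := king_path_col pq; rewrite lqn.
  exists k, (take k (map pt q)); split.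
  + by rewrite leq_ord size_takel /=.
  + exact: take_path.
  + exact: (take_uniq k.+1 uqn).
  + apply/allP => x xk; move/allP: zq; apply.
    exact: (@mem_take k.+1 _ (_ :: _)).
(* The chain of boundary edges ending in g contradicts Stokes' theorem. *)
exfalso.
pose h i j := m i j && g i.+1 j || g i j && m i.+1 j.
pose v i j := m i j && g i j.+1 || g i j && m i j.+1.
have mF i j : (N <= i) || (N <= j) -> m i j = false.
  by move=> ij; apply/negP => /mN; lia.
have gm i j : g i j -> m i j = false by move=> /gz /zm /negbTE.
suff : \big[addb/false]_(i < N) h i 0 = true.
  rewrite (@square_stokes h v N) //.
  - move=> i j iN jN; rewrite /h /v.
    have [G|] := boolP [|| g i j, g i.+1 j, g i j.+1 | g i.+1 j.+1]; last first.
      rewrite !negb_or => /and4P[/negbTE-> /negbTE-> /negbTE-> /negbTE->].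
      by rewrite !andbF.
    (* All sites of a plaquette are king neighbours of one another. *)
    have zg i' j' : (i' == i) || (i' == i.+1) -> (j' == j) || (j' == j.+1) ->
        z i' j' -> g i' j'.
      move=> i'P j'P zij'; have iN' : i' <= N by lia.
      have jN' : j' <= N by lia.
      have K i1 j1 : (i1 == i) || (i1 == i.+1) -> (j1 == j) || (j1 == j.+1) ->
          g i1 j1 -> g i' j'.
        move=> i1P j1P g1; apply: gK iN' jN' g1 zij'.
        apply/allpairsPdep; exists i', j'; split=> //; rewrite !inE /=.
          by case/orP: i1P => /eqP->; case/orP: i'P => /eqP-> /=;
             rewrite ?eqxx ?orbT.
        by case/orP: j1P => /eqP->; case/orP: j'P => /eqP-> /=;
           rewrite ?eqxx ?orbT.
      by case/or4P: G => /K; rewrite !eqxx ?orbT /=; apply.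
    have zm' i' j' i2 j2 : (i2 == i) || (i2 == i.+1) ->
        (j2 == j) || (j2 == j.+1) ->
        (m i' j' -> m i2 j2 || z i2 j2) -> m i' j' -> m i2 j2 || g i2 j2.
      by move=> i2P j2P mz /mz /orP[->//|/(zg _ _ i2P j2P) ->]; rewrite orbT.
    rewrite !boundary_edgeE;
      do ?[exact: gm | by apply: zm'; rewrite ?eqxx ?orbT; auto].
    by case: (m i j); case: (m i.+1 j); case: (m i j.+1); case: (m i.+1 j.+1).
  - by move=> i iN; rewrite /h !mF ?leqnn ?orbT // andbF.
  - by move=> j jN; rewrite /v !g0 /= !(mF N) ?leqnn // !andbF.
(* On the horizontal axis every boundary edge is in the chain, and there is an
   odd number of them, as the corner is in m and (N, 0) is not. *)
have hE i : i < N -> h i 0 = m i 0 (+) m i.+1 0.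
  move=> iN; rewrite /h.
  have gb k : k <= N -> z k 0 -> g k 0.
    move=> kN zk; apply/and4P; split=> //; apply/existsP; exists (inord k).
    by rewrite inordK // zk /= connect0.
  apply: boundary_edgeE; [|exact: gm|exact: gm|].
    by move=> /hR /orP[->//|/(gb _ iN) ->]; rewrite orbT.
  by move=> /hL /orP[->//|/(gb _ (ltnW iN)) ->]; rewrite orbT.
rewrite (eq_bigr (fun i : 'I_N => m i 0 (+) m i.+1 0)); last first.
  by move=> i _; exact: hE.
have tele n : \big[addb/false]_(i < n) (m i 0 (+) m i.+1 0) = m 0 0 (+) m n 0.
  elim: n => [|n IHn]; first by rewrite big_ord0 addbb.
  by rewrite big_ord_recr /= IHn addbA addbK.
by rewrite tele m00 mF ?leqnn.
Qed.

(** The walks of [k] steps from [x], starting point included. *)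
Fixpoint king_walks k (x : nat * nat) : seq (seq (nat * nat)) :=
  if k is k'.+1 then [seq x :: p | y <- king_nbrs x, p <- king_walks k' y]
  else [:: [:: x]].

Lemma king_walksS k x :
  king_walks k.+1 x = [seq x :: p | y <- king_nbrs x, p <- king_walks k y].
Proof. by []. Qed.

Lemma size_king_walks k x : size (king_walks k x) = 9 ^ k.
Proof.
elim: k x => //= k IH x; rewrite !size_cat !size_map !IH expnS /=.
by move: (9 ^ k) => n; lia.
Qed.

Lemma size_in_king_walks k x p : p \in king_walks k x -> size p = k.+1.
Proof.
elim: k x p => [|k IH] x p; first by rewrite inE => /eqP ->.
by rewrite king_walksS; case/allpairsPdep => y [q [_ /IH sq ->]] /=; rewrite sq.
Qed.

Lemma mem_king_walks x p :
  path (fun x y => y \in king_nbrs x) x p -> x :: p \in king_walks (size p) x.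
Proof.
elim: p x => [|y p IH] x; first by rewrite inE.
rewrite [path _ _ _]/= [size _]/= king_walksS => /andP[xy /IH yp].
by apply/allpairsPdep; exists y, (y :: p).
Qed.

(** * Spins *)

Import Order.TTheory GRing.Theory Num.Theory.
Import numFieldNormedType.Exports.
Local Open Scope classical_set_scope.
Local Open Scope ring_scope.

Definition compat (a b : spin) : bool := \val a * \val b != -1.

Lemma spinP (a : spin) : [|| \val a == -1, \val a == 0 | \val a == 1].
Proof. by have := valP a; rewrite !inE. Qed.

Lemma compatC a b : compat a b = compat b a.
Proof. by rewrite /compat mulrC. Qed.

Lemma compat0l a : compat spin0 a.
Proof. by rewrite /compat mul0r. Qed.

Lemma compat0r a : compat a spin0.
Proof. by rewrite compatC compat0l. Qed.

Lemma compatxx a : compat a a.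
Proof. by rewrite /compat; case/or3P: (spinP a) => /eqP ->. Qed.

Lemma spin_neq0 (a : spin) : (a != spin0) = (\val a != 0).
Proof. by rewrite -val_eqE. Qed.

Lemma compat_eq a b : a != spin0 -> b != spin0 -> compat a b -> a = b.
Proof.
rewrite !spin_neq0 /compat => a0 b0 ab; apply/val_inj.
by move: a0 b0 ab; case/or3P: (spinP a) => /eqP ->;
  case/or3P: (spinP b) => /eqP ->.
Qed.

Lemma spin_sqr (R : pzRingType) (a : spin) :
  (\val a)%:~R ^+ 2 = (a != spin0)%:R :> R.
Proof.
rewrite spin_neq0; case/or3P: (spinP a) => /eqP -> /=.
- by rewrite mulrN1z sqrrN expr1n.
- by rewrite expr0n.
- by rewrite expr1n.
Qed.

(** * Removing zeros from a hard-core configuration *)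

Section Graph.
Context (d : nat).
Implicit Types (i j : site d) (S L : {fset site d}) (xi : config d).

Lemma adjC i j : adj i j = adj j i.
Proof. by rewrite /adj; under eq_bigr do rewrite distrC. Qed.

(** Displacements with entries in {-1, 0, 1}, coded by [1 - t k]: a finite index
    set, independent of the site, that reaches all nearest neighbours. *)
Definition box_shift i (t : {ffun 'I_d -> 'I_3}) : site d :=
  \row_k (i 0 k + 1 - (t k : nat)%:Z).

Lemma adj_box_shift i j : adj i j -> exists t, box_shift i t = j.
Proof.
move=> /eqP ij.
have le1 k : `|i 0 k - j 0 k| <= 1.
  by rewrite -ij (bigD1 k) //= lerDl sumr_ge0.
exists [ffun k : 'I_d => inord `|(i 0 k - j 0 k + 1)%R|%N].
apply/rowP => k; rewrite mxE ffunE inordK; last by have := le1 k; lia.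
by have := le1 k; lia.
Qed.

Definition feasible xi := forall i j, adj i j -> compat (xi i) (xi j).

(** The union of the occupied clusters of [xi] that have a site next to [S]. *)
Inductive touched S xi : site d -> Prop :=
| Touched0 i j : i \in S -> adj i j -> xi j != spin0 -> touched S xi j
| TouchedS i j : touched S xi i -> adj i j -> xi j != spin0 -> touched S xi j.

Definition fill (s : spin) S xi : config d := fun i =>
  if i \in S then s
  else if (xi i != spin0) && `[< touched S xi i >] then s else xi i.

Lemma fill_neq0 s S xi i : s != spin0 ->
  (fill s S xi i != spin0) = (i \in S) || (xi i != spin0).
Proof.
move=> s0; rewrite /fill; case: ifPn => // _ /=; case: ifPn => //.
by rewrite s0 => /andP[->].
Qed.

Lemma touched_neq0 S xi i : touched S xi i -> xi i != spin0.
Proof. by case. Qed.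

(** Adjacent occupied sites outside [S] are in the same cluster, so that both or
    none of them are recoloured; an occupied site next to [S] is recoloured. *)
Lemma fill_feasible s S xi :
  feasible xi -> (forall i, i \in S -> xi i = spin0) -> feasible (fill s S xi).
Proof.
move=> fxi xiS i j ij; rewrite /fill.
have T i1 j1 :
    i1 \in S -> adj i1 j1 -> xi j1 != spin0 -> `[< touched S xi j1 >].
  by move=> iS ij1 j0; apply/asboolP; exact: (Touched0 iS).
have [iS|iS] := boolP (i \in S); have [jS|jS] := boolP (j \in S);
  first exact: compatxx.
- have [->|j0] := eqVneq (xi j) spin0; first by rewrite compat0r.
  by rewrite (T i) // compatxx.
- have [->|i0] := eqVneq (xi i) spin0; first by rewrite compat0l.
  by rewrite (T j) ?compatxx // adjC.
have [->|i0] := eqVneq (xi i) spin0; first by rewrite compat0l.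
have [->|j0] /= := eqVneq (xi j) spin0; first by rewrite compat0r.
have -> : `[< touched S xi i >] = `[< touched S xi j >].
  apply/asboolP/asboolP => t; first exact: (TouchedS t).
  by apply: (TouchedS t) => //; rewrite adjC.
by case: ifP => _; [exact: compatxx|exact: fxi].
Qed.

(** The zeros off [S] are not changed by filling, hence [xi] and [eta] have the
    same occupied sites. A touched cluster is monochromatic and has a site next
    to [S], where the two configurations agree; by induction along the cluster
    they agree on all of it. *)
Lemma fill_inj s S xi eta : s != spin0 -> feasible xi -> feasible eta ->
  (forall i, i \in S -> xi i = spin0) -> (forall i, i \in S -> eta i = spin0) ->
  (forall i j, i \in S -> adj i j -> xi j = eta j) ->
  fill s S xi = fill s S eta -> xi = eta.
Proof.
move=> s0.
have H xi1 xi2 : feasible xi1 -> feasible xi2 ->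
    (forall i, i \in S -> xi1 i = spin0) ->
    (forall i j, i \in S -> adj i j -> xi1 j = xi2 j) ->
    fill s S xi1 = fill s S xi2 ->
    forall i, touched S xi1 i -> xi1 i = xi2 i.
  move=> f1 f2 S1 rec ff i; elim=> [i' j iS ij _|i' j ti IH ij j0].
    exact: rec ij.
  have j0' : xi2 j != spin0.
    have := congr1 (fun z => z j != spin0) ff; rewrite !fill_neq0 // j0 orbT.
    by have [/S1 jS|//] := boolP (j \in S); rewrite jS in j0.
  have i0 := touched_neq0 ti; have i0' : xi2 i' != spin0 by rewrite -IH.
  by rewrite -(compat_eq i0 j0 (f1 _ _ ij)) IH (compat_eq i0' j0' (f2 _ _ ij)).
move=> fx fe Sx Se rec ff; apply/funext => i.
have [iS|iS] := boolP (i \in S); first by rewrite Sx ?Se.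
have [tx|tx] := pselect (touched S xi i); first exact: H tx.
have [te|te] := pselect (touched S eta i).
  by apply/esym; apply: H te => // i' j iS' ij; rewrite (rec i').
have := congr1 (fun z => z i) ff; rewrite /fill (negbTE iS).
by rewrite (asboolF tx) (asboolF te) !andbF.
Qed.

End Graph.

Section Weight.
Context (R : realType) (d : nat) (lambda : R).
Hypothesis lambda_gt0 : 0 < lambda.
Implicit Types (S L : {fset site d}) (xi : config d).

(** With a constant spin outside [L] the edges that do not meet [L] satisfy the
    constraint, so that the weight sees the constraint on the whole graph. *)
Lemma hc_weight_feasible L s xi : (forall i, i \notin L -> xi i = s) ->
  hc_weight lambda 0 L xi =
  (`[< feasible xi >])%:R * \prod_(i <- L) lambda ^+ (xi i != spin0).
Proof.
move=> xiL; rewrite hc_weightE; congr (_ * _); last first.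
  rewrite expR_sum; apply: eq_bigr => i _.
  rewrite mul0r addr0 spin_sqr; case: (_ != _).
    by rewrite mulr1 lnK ?posrE.
  by rewrite mulr0 expR0.
case: asboolP => [fxi|nfxi].
  rewrite big_seq big1 // => e; rewrite in_fset_set ?inE; last exact: finite_bdedges.
  move=> [[i j] /= /andP[ij _] <-].
  suff -> : hardcore xi [fset i; j]%fset by [].
  apply/asboolP => a b /fsetP ab.
  suff /orP[/eqP->|ab'] : (a == b) || adj a b; first exact: compatxx.
    exact: fxi.
  have := ab a; have := ab b; rewrite !inE !eqxx !orbT.
  by do 2![move=> /orP[/eqP->|/eqP->]]; rewrite ?eqxx ?ij ?(adjC j i) ?ij ?orbT.
have [i [j [ij nij]]] : exists i j, adj i j /\ ~~ compat (xi i) (xi j).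
  apply: contrapT => H; apply: nfxi => i j ij; apply: contrapT => c.
  by apply: H; exists i, j; split => //; apply/negP.
have ijL : (i \in L) || (j \in L).
  apply: contraNT nij; rewrite negb_or => /andP[/xiL -> /xiL ->].
  exact: compatxx.
have eL : [fset i; j]%fset \in fset_set (bdedges L).
  rewrite in_fset_set ?inE; last exact: finite_bdedges.
  by exists (i, j) => //=; rewrite ij.
rewrite (big_fsetD1 _ eL) /=.
suff -> : hardcore xi [fset i; j]%fset = false by rewrite mul0r.
by apply/negP => /asboolP /(_ i j erefl) c; move: nij; rewrite /compat c.
Qed.


(** The map [F] below is injective on the feasible configurations vanishing on
    [S]: its first component is the filled configuration and its second one
    records the spins around [S]. Filling multiplies the weight by
    [lambda ^+ #|` S|]. *)
Lemma hc_weight_zero_le L S s : s != spin0 ->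
  \sum_(w : {ffun L -> spin} | [forall i : S, glue w (fun=> s) (val i) == spin0])
     hc_weight lambda 0 L (glue w (fun=> s)) <=
  ((3 ^ (3 ^ d))%:R / lambda) ^+ #|` S| * hc_Z lambda 0 L (fun=> s).
Proof.
move=> s0; set eta : config d := fun=> s; set c : R := _ / lambda.
have c0 : 0 <= c by rewrite divr_ge0 // ltW.
have [SL|nSL] := boolP (S `<=` L)%fset; last first.
  rewrite big_pred0 ?mulr_ge0 ?exprn_ge0 // ?ltW ?hc_Z_gt0 // => w.
  have /fsubsetPn[i iS iL] := nSL; apply/negP => /forallP /(_ (FSetSub iS)) /=.
  by rewrite glue_out // (negbTE s0).
pose G (w : {ffun L -> spin}) := glue w eta.
pose Z (w : {ffun L -> spin}) := [forall i : S, G w (val i) == spin0].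
have ZP w : Z w -> forall i, i \in S -> G w i = spin0.
  by move=> /forallP Zw i iS; have /eqP := Zw (FSetSub iS).
have Gout w i : i \notin L -> G w i = s by move=> iL; rewrite /G glue_out.
pose rec (w : {ffun L -> spin}) : {ffun S * {ffun 'I_d -> 'I_3} -> spin} :=
  [ffun p => G w (box_shift (val p.1) p.2)].
pose F w := (restr L (fill s S (G w)), rec w).
have GF w : Z w -> G (F w).1 = fill s S (G w).
  move=> Zw; apply: glue_restr => i iL; rewrite /fill Gout // if_same.
  by case: ifP.
pose A := [set w | Z w && `[< feasible (G w) >]]%SET.
have Finj : {in A &, injective F}.
  move=> w1 w2; rewrite !inE => /andP[Z1 /asboolP f1] /andP[Z2 /asboolP f2] F12.
  rewrite -(restr_glue w1 eta) -(restr_glue w2 eta); congr restr.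
  apply: (@fill_inj _ s S _ _ s0 f1 f2 (ZP _ Z1) (ZP _ Z2)).
    move=> i j iS /adj_box_shift[t <-].
    have /ffunP/(_ (FSetSub iS, t)) := congr1 snd F12.
    by rewrite /= !ffunE.
  by rewrite -!GF // F12.
have wF w : w \in A -> hc_weight lambda 0 L (G w) =
    lambda ^- #|` S| * hc_weight lambda 0 L (G (F w).1).
  rewrite inE => /andP[Zw /asboolP fw].
  rewrite !(@hc_weight_feasible L s) //; try exact: Gout.
  rewrite GF // (asboolT fw) (asboolT (fill_feasible s fw (ZP _ Zw))) !mul1r.
  under [in RHS]eq_bigr => i _ do rewrite fill_neq0 //.
  rewrite [in RHS](eq_bigr
    (fun i => lambda ^+ (i \in S) * lambda ^+ (G w i != spin0))); last first.
    move=> i _; have [iS|iS] /= := boolP (i \in S); last by rewrite expr0 mul1r.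
    by rewrite (ZP w) // eqxx mulr1.
  rewrite big_split /= mulrA -[LHS]mul1r; congr (_ * _).
  rewrite (_ : \prod_(i <- L) lambda ^+ (i \in S) = lambda ^+ #|` S|).
    by rewrite mulVf // expf_neq0 // gt_eqF.
  transitivity (\prod_(i <- L | i \in S) lambda).
    by rewrite [RHS]big_mkcond; apply: eq_bigr => i _; case: ifP.
  rewrite big_fset_condE /=.
  rewrite (_ : [fset i in L | i \in S]%fset = S); last first.
    by apply/fsetP => i; rewrite !inE /= andb_idl // => /(fsubsetP SL).
  by rewrite big_const_seq count_predT iter_mulr_1 cardfE -cardfE.
rewrite (bigID (fun w => w \in A)) /= [X in _ + X]big1 ?addr0; last first.
  move=> w /andP[Zw]; rewrite inE -/(Z w) [Z w]Zw /= => nf.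
  by rewrite (@hc_weight_feasible L s) ?(negbTE nf) ?mul0r //; exact: Gout.
rewrite (eq_bigl (fun w => w \in A)); last first.
  by move=> w; rewrite inE; rewrite -/(Z w); case: (Z w).
rewrite (eq_bigr (fun w => lambda ^- #|` S| * hc_weight lambda 0 L (G (F w).1))) //.
rewrite -mulr_sumr expr_div_n mulrC -mulrA [X in _ <= X]mulrC -mulrA.
rewrite mulrC [X in _ <= _ * X]mulrC ler_pM2l ?invr_gt0 ?exprn_gt0 //.
rewrite -(big_imset (fun p => hc_weight lambda 0 L (G p.1)) Finj) /=.
apply: (@le_trans _ _ (\sum_p hc_weight lambda 0 L (G p.1))).
  rewrite [X in _ <= X](bigID (fun p => p \in F @: A)) /= lerDl.
  by apply: sumr_ge0 => p _; exact: hc_weight_ge0.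
rewrite -(pair_bigA _ (fun w _ => hc_weight lambda 0 L (G w))) /=.
under eq_bigr do rewrite sumr_const.
rewrite sumrMnl -[X in X <= _]mulr_natl -natrX.
apply: ler_wpM2r; first by apply: ltW; exact: hc_Z_gt0.
rewrite ler_nat.
suff E : #|{: {ffun S * {ffun 'I_d -> 'I_3} -> spin}}| = ((3 ^ 3 ^ d) ^ #|` S|)%N.
  by rewrite -E; exact: leqnn.
rewrite card_ffun card_prod card_ffun !card_ord -expnM mulnC.
by rewrite card_seq_sub // cardfE.
Qed.

End Weight.

(** * The Peierls estimate *)

Definition quadrant d (x : nat * nat) : site d.+2 :=
  \row_k (if k == ord0 then x.1%:Z else if k == lift ord0 ord0 then x.2%:Z else 0).

Lemma quadrant_inj d : injective (@quadrant d).
Proof.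
move=> [a b] [a' b'] /rowP H.
by have := H ord0; have := H (lift ord0 ord0); rewrite !mxE /= => -[->] [->].
Qed.

Lemma adj_right d i j : adj (@quadrant d (i, j)) (quadrant d (i.+1, j)).
Proof.
rewrite /adj !big_ord_recl big1 => [|k _]; rewrite !mxE /=; last by rewrite subrr normr0.
by rewrite subrr normr0 !addr0; lia.
Qed.

Lemma adj_up d i j : adj (@quadrant d (i, j)) (quadrant d (i, j.+1)).
Proof.
rewrite /adj !big_ord_recl big1 => [|k _]; rewrite !mxE /=; last by rewrite subrr normr0.
by rewrite subrr normr0 !addr0 add0r; lia.
Qed.

Lemma fset_quadrant_bounded d (L : {fset site d.+2}) :
  exists N, forall i j, quadrant d (i, j) \in L -> (i < N)%N && (j < N)%N.
Proof.
pose f (x : site d.+2) := (`|x ord0 ord0| + `|x ord0 (lift ord0 ord0)|)%N.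
exists (\max_(x <- L) f x).+1 => i j ijL.
have : (f (quadrant d (i, j)) <= \max_(x <- L) f x)%N.
  exact: (@leq_bigmax_seq _ _ xpredT f).
by rewrite /f !mxE /= !ltnS; lia.
Qed.

Section FiniteVolume.
Context (R : realType) (d : nat) (lambda h : R).
Implicit Types (L : {fset site d}) (eta : config d) (A B : set (config d)).

(** The finite-volume measure as a real-valued function; it is defined on all
    sets because it has finitely many atoms. *)
Definition hc_pr L eta A : R :=
  \sum_(w : {ffun L -> spin}) hc_prob lambda h eta w * \1_A (glue w eta).

Lemma hc_pr_bool L eta (b : pred (config d)) :
  hc_pr L eta [set xi | b xi] =
  \sum_(w : {ffun L -> spin}) hc_prob lambda h eta w * (b (glue w eta))%:R.
Proof.
apply: eq_bigr => w _; rewrite indicE; congr (_ * (nat_of_bool _)%:R).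
by apply/idP/idP; rewrite inE.
Qed.

Lemma hc_pr_ge0 L eta A : 0 <= hc_pr L eta A.
Proof. by apply: sumr_ge0 => w _; rewrite mulr_ge0 ?hc_prob_ge0. Qed.

Lemma hc_pr_le1 L eta A : hc_pr L eta A <= 1.
Proof.
rewrite -(hc_prob_sum lambda h L eta); apply: ler_sum => w _.
by rewrite ler_piMr ?hc_prob_ge0 // indicE lern1 leq_b1.
Qed.

Lemma hc_prT L eta : hc_pr L eta setT = 1.
Proof.
by rewrite /hc_pr; under eq_bigr do rewrite indicT mulr1; rewrite hc_prob_sum.
Qed.

Lemma hc_prU L eta A B : A `&` B = set0 ->
  hc_pr L eta (A `|` B) = hc_pr L eta A + hc_pr L eta B.
Proof.
move=> AB; rewrite /hc_pr -big_split /=; apply: eq_bigr => w _.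
rewrite -mulrDr !indicE in_setU; congr (_ * _).
have [Aw|] := boolP (_ \in A); last by rewrite add0r.
have [Bw|] := boolP (_ \in B); last by rewrite addr0.
by move: Aw Bw; rewrite !inE => Aw Bw; exfalso;
  rewrite -[False]/(set0 (glue w eta)) -AB.
Qed.

End FiniteVolume.

Section Peierls.
Context (R : realType) (d : nat) (lambda : R).
Hypothesis lambda_gt0 : 0 < lambda.
Implicit Types (S L : {fset site d.+2}) (xi : config d.+2).

Local Notation eps := ((3 ^ (3 ^ d.+2))%:R / lambda).

Lemma hc_pr_zero L s S : s != spin0 ->
  hc_pr lambda 0 L (fun=> s) [set xi | [forall i : S, xi (val i) == spin0]] <=
  eps ^+ #|` S|.
Proof.
move=> s0; rewrite hc_pr_bool.
under eq_bigr do rewrite mulr_natr mulrb.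
rewrite -big_mkcond -mulr_suml ler_pdivrMr ?hc_Z_gt0 //.
exact: hc_weight_zero_le.
Qed.

(** If the spin at the origin is neither [s] nor zero, it is -s. The sites of
    spin -s lie in the finite volume, and a neighbour of such a site is zero
    unless it also has spin -s. If the spin at the origin is zero, the walk of
    length zero will do. *)
Lemma wrong_spin_circuit L s xi N : s != spin0 -> feasible xi ->
  (forall i, i \notin L -> xi i = s) ->
  (forall i j, quadrant d (i, j) \in L -> (i < N)%N && (j < N)%N) ->
  xi 0 != s ->
  exists k, exists2 p, p \in king_walks k (k, 0%N) &
    [&& (k <= N)%N, uniq p & all (fun x => xi (quadrant d x) == spin0) p].
Proof.
move=> s0 fxi xiL LN x0s.
have q00 : quadrant d (0%N, 0%N) = 0.
  by apply/rowP => k; rewrite !mxE /=; case: ifP => // _; case: ifP.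
have [x00|x00] := eqVneq (xi 0) spin0.
  exists 0%N, [:: (0%N, 0%N)]; first by rewrite inE.
  by rewrite /= q00 x00 eqxx.
pose m i j := (xi (quadrant d (i, j)) != spin0) && (xi (quadrant d (i, j)) != s).
pose z i j := xi (quadrant d (i, j)) == spin0.
have mz i j i' j' : adj (quadrant d (i, j)) (quadrant d (i', j')) ->
    m i j -> m i' j' || z i' j'.
  move=> ij; rewrite /m /z orbC.
  case: (eqVneq (xi (quadrant d (i', j'))) spin0) => [//|y0] /andP[x0 xs].
  by rewrite -(compat_eq x0 y0 (fxi _ _ ij)) xs.
have [| | | | | | |k [p [/andP[kN /eqP sp] kp up zp]]] := @quadrant_circuit m z N.
- by rewrite /m q00 x00 x0s.
- move=> i j /andP[_ xs]; apply: LN; apply: contraNT xs => /xiL ->.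
  by rewrite eqxx.
- by move=> i j; rewrite /z /m => ->.
- by move=> i j; apply: mz; exact: adj_right.
- by move=> i j; apply: mz; rewrite adjC; exact: adj_right.
- by move=> i j; apply: mz; exact: adj_up.
- by move=> i j; apply: mz; rewrite adjC; exact: adj_up.
exists k, ((k, 0%N) :: p).
  by have := mem_king_walks kp; rewrite sp.
rewrite kN up /=; move: zp; rewrite /= /z => /andP[->] /=.
by apply: sub_all => -[a b].
Qed.

(** Union bound over the [9 ^ k] walks from [(k, 0)]. The assumption on [lambda]
    gives [eps <= 1 / 12], for which the geometric series is
    [(1 / 12) / (1 - 9 / 12) = 1 / 3]. *)
Lemma hc_pr_wrong_spin L s : s != spin0 -> 12 * (3 ^ (3 ^ d.+2))%:R <= lambda ->
  hc_pr lambda 0 L (fun=> s) [set xi | xi 0 != s] <= 3^-1.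
Proof.
move=> s0 large; have [N LN] := fset_quadrant_bounded L.
set e := eps; have e0 : 0 <= e by rewrite divr_ge0 // ltW.
have e12 : e <= 12^-1.
  by rewrite ler_pdivrMr // mulrC ler_pdivlMr // mulrC.
pose zero (p : seq (nat * nat)) xi := all (fun x => xi (quadrant d x) == spin0) p.
have zeroP k p : p \in king_walks k (k, 0%N) -> uniq p ->
    hc_pr lambda 0 L (fun=> s) [set xi | zero p xi] <= e ^+ k.+1.
  move=> kp up; pose S := [fset quadrant d x | x in p]%fset.
  have <- : #|` S| = k.+1.
    rewrite card_imfset /=; last exact: quadrant_inj.
    by rewrite undup_id // (size_in_king_walks kp).
  apply: le_trans (hc_pr_zero L S s0); rewrite !hc_pr_bool; apply: ler_sum => w _.
  apply: ler_wpM2l; first exact: hc_prob_ge0.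
  rewrite ler_nat; case: (boolP (zero p _)) => // zp.
  suff -> : [forall i : S, glue w (fun=> s) (val i) == spin0] by [].
  apply/forallP => -[i /= iS]; case/imfsetP: (iS) => x /= xp ->.
  by move/allP: zp; apply.
apply: (@le_trans _ _ (\sum_(k < N.+1)
    \sum_(p <- king_walks k (k : nat, 0%N) | uniq p)
      hc_pr lambda 0 L (fun=> s) [set xi | zero p xi])).
  rewrite hc_pr_bool.
  under [X in _ <= X]eq_bigr do
    (under eq_bigr do rewrite hc_pr_bool; rewrite exchange_big).
  rewrite exchange_big /=; apply: ler_sum => w _.
  under [X in _ <= X]eq_bigr do rewrite -mulr_sumr.
  rewrite -mulr_sumr; set xi := glue w _.
  have [fxi|nfxi] := pselect (feasible xi); last first.
    rewrite /hc_prob (@hc_weight_feasible _ _ _ _ L s) //.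
      by rewrite (asboolF nfxi) !mul0r.
    by move=> i iL; rewrite glue_out.
  apply: ler_wpM2l; first exact: hc_prob_ge0.
  have sum0 : 0 <= \sum_(k < N.+1)
      \sum_(p <- king_walks k (k : nat, 0%N) | uniq p) (zero p xi)%:R :> R.
    by apply: sumr_ge0 => k _; apply: sumr_ge0.
  case: (boolP (xi 0 != s)) => //= x0s.
  have [|k [p kp /and3P[kN up zp]]] := @wrong_spin_circuit L s xi N s0 fxi _ LN x0s.
    by move=> i iL; rewrite /xi glue_out.
  rewrite (bigD1 (Ordinal (kN : (k < N.+1)%N))) //= ler_wpDr //.
    by apply: sumr_ge0 => ? _; apply: sumr_ge0.
  rewrite -big_filter (big_rem p) /=; last by rewrite mem_filter up.
  by rewrite [zero p xi]zp lerDl sumr_ge0.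
apply: (@le_trans _ _ (\sum_(k < N.+1) (9 ^ k)%:R * e ^+ k.+1)).
  apply: ler_sum => k _; rewrite -(size_king_walks k (k : nat, 0%N)).
  rewrite -sum1_size natr_sum mulr_suml big_mkcond /= !big_seq.
  apply: ler_sum => p kp; case: ifP => up; first by rewrite mul1r zeroP.
  by rewrite mul1r exprn_ge0.
have H n : \sum_(k < n) (9 ^ k)%:R * e ^+ k.+1 <= 3^-1 * (1 - (3 / 4) ^+ n).
  elim: n => [|n IH]; first by rewrite big_ord0 expr0 subrr mulr0.
  rewrite big_ord_recr /=; apply: le_trans (lerD IH (lexx _)) _.
  have K : (9 ^ n)%:R * e ^+ n.+1 <= (3 / 4) ^+ n * 12^-1.
    rewrite natrX exprSr mulrA -exprMn; apply: ler_pM => //.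
      by rewrite exprn_ge0 // mulr_ge0.
    by apply: lerXn2r; rewrite ?nnegrE; move: e0 e12; clearbody e; lra.
  rewrite [(3 / 4) ^+ n.+1]exprSr; move: K; move: ((3 / 4) ^+ n) (_ * e ^+ _) => x y.
  by move: x y; clear => x y; lra.
apply: le_trans (H _) _; rewrite ler_piMr // lerBlDr lerDl exprn_ge0 //.
Qed.

End Peierls.

(** * From finitely additive means to measures *)

(** The events that depend on finitely many spins. *)
Definition local d (A : set (config d)) := exists N : {fset site d},
  forall xi eta, (forall i, i \in N -> xi i = eta i) -> A xi -> A eta.

Section LocalAlgebra.
Context (d : nat).
Implicit Types A B : set (config d).

Lemma local0 : local (@set0 (config d)).
Proof. by exists fset0. Qed.

Lemma localU A B : local A -> local B -> local (A `|` B).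
Proof.
move=> [N AN] [M BM]; exists (N `|` M)%fset => xi eta e [Ax|Bx]; [left|right].
  by apply: AN Ax => i iN; apply: e; rewrite inE iN.
by apply: BM Bx => i iM; apply: e; rewrite inE iM orbT.
Qed.

Lemma localC A : local A -> local (~` A).
Proof.
move=> [N AN]; exists N => xi eta e nAx Ae; apply: nAx.
by apply: AN Ae => i iN; rewrite e.
Qed.

Lemma measurable_local A : local A -> measurable (A : set (configT d)).
Proof.
move=> [N AN].
have mf : measurable_fun [set: configT d] (fun xi => `[< A xi >]).
  apply: (@measurable_fin d _ bool setT N) => // xi eta e.
  by apply/asboolP/asboolP; apply: AN => // i /e ->.
have := mf measurableT [set true] I; rewrite setTI.
by congr (measurable _); apply/seteqP; split=> xi /= /asboolP.
Qed.

(** Compactness of the configuration space in the product topology, for which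
    local events are open and closed: a sequence of configurations in [A] that
    avoids more and more of the [F k] has, along an ultrafilter, a limit at
    each site, as there are finitely many spins; the limit is in [A] and in no
    [F k]. *)
Lemma local_compact A (F : nat -> set (config d)) :
  local A -> (forall n, local (F n)) -> A `<=` \bigcup_n F n ->
  exists n, A `<=` \big[setU/set0]_(k < n) F k.
Proof.
move=> lA lF AF; apply: contrapT => noN.
have /choice[x xP] n : exists xi, A xi /\ forall k, (k < n)%N -> ~ F k xi.
  apply: contrapT => H; apply: noN; exists n => xi Axi.
  rewrite -bigcup_mkord; apply: contrapT => nF; apply: H; exists xi; split=> //.
  by move=> k kn Fk; apply: nF; exists k.
have [U [UU ooU]] := ultraFilterLemma (@eventually_filter).
have PU : ProperFilter U by exact: ultra_proper.
have Uval i : exists a, U [set n | x n i = a].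
  apply: contrapT => H.
  have UC a : U [set n | x n i <> a].
    have [Ua|//] := in_ultra_setVsetC [set n | x n i = a] UU.
    by exfalso; apply: H; exists a.
  by have /filter_ex[n /(_ (x n i))] := filter_forall PU UC.
have /choice[xi xiP] := Uval.
have UN (N : {fset site d}) : U [set n | forall i, i \in N -> x n i = xi i].
  have : U (\bigcap_(i in [set` N]) [set n | x n i = xi i]).
    by apply: filter_bigI.
  by apply: filterS => n H i iN; exact: H.
have [NA NAP] := lA.
have Axi : A xi.
  by have /filter_ex[n Hn] := UN NA; apply: NAP Hn _; have [] := xP n.
have [k _ Fkx] := AF _ Axi; have [NF NFP] := lF k.
have : U [set n | (k < n)%N] by apply: ooU; exists k.+1.
move=> /(filterI (UN NF))/filter_ex[n [Hn kn]].
have [_ /(_ k kn)] := xP n; apply; apply: NFP Fkx => i iN; exact/esym/Hn.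
Qed.

End LocalAlgebra.

(** A copy of the configuration space carrying the algebra of local events. *)
Definition local_config (d : nat) := config d.
Fact local_display : measure_display. Proof. exact: default_measure_display. Qed.
HB.instance Definition _ d := Pointed.on (local_config d).
HB.instance Definition _ d := @isAlgebraOfSets.Build local_display
  (local_config d) (@local d) (@local0 d) (@localU d) (@localC d).

Section Extension.
Context (R : realType) (d : nat) (p : set (config d) -> R).
Hypothesis p_ge0 : forall A, 0 <= p A.
Hypothesis pT : p setT = 1.
Hypothesis pU : forall A B, A `&` B = set0 -> p (A `|` B) = p A + p B.

Definition mean_content (A : set (local_config d)) : \bar R := (p A)%:E.

Let mean_content_ge0 A : (0 <= mean_content A)%E.
Proof. by rewrite lee_fin. Qed.

Let p0 : p set0 = 0.
Proof. by have := pU (set0I set0); rewrite setU0; lra. Qed.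

Let mean_content_additive : measure_function.semi_additive mean_content.
Proof.
move=> F n _ tF _; rewrite /mean_content sumEFin; congr EFin.
elim: n => [|n IH]; first by rewrite !big_ord0 p0.
rewrite !big_ord_recr /= pU ?IH // -subset0 -bigcup_mkord.
move=> xi [[k /= kn Fk] Fn].
have : k = n by apply: tF => //; exists xi.
by move=> E; rewrite E ltnn in kn.
Qed.

HB.instance Definition _ := isContent.Build _ _ _ mean_content
  mean_content_ge0 mean_content_additive.

Let mean_content_sigma_subadditive :
  measurable_subset_sigma_subadditive mean_content.
Proof.
move=> A F mF mA AF; have [n An] := local_compact mA mF AF.
have sub : (mean_content A <= \sum_(k < n) mean_content (F k))%E.
  by apply: content_subadditive => // k _; exact: mF.
apply: le_trans sub _.
rewrite -(big_mkord xpredT (fun k => mean_content (F k))).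
by apply: nneseries_lim_ge => k _ _.
Qed.

HB.instance Definition _ := Content_SigmaSubAdditive_isMeasure.Build _ _ _
  mean_content mean_content_sigma_subadditive.

Let generated := g_sigma_algebraType (@measurable _ (local_config d)).

Let measurable_generated (A : set (config d)) :
  measurable (A : set (configT d)) -> measurable (A : set generated).
Proof.
suff : <<s cylinders [set: site d] >> `<=` <<s @local d >> by apply.
apply: sub_sigma_algebra2 => _ [i _ [B _ <-]].
by exists [fset i]%fset => xi eta e /=; rewrite e // inE.
Qed.

Definition mean_measure (A : set (configT d)) : \bar R :=
  measure_extension mean_content (A : set generated).

Let mean_measure0 : mean_measure set0 = 0%E.
Proof. exact: measure0. Qed.

Let mean_measure_ge0 A : (0 <= mean_measure A)%E.
Proof. exact: measure_ge0. Qed.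

Let mean_measure_sigma_additive : semi_sigma_additive mean_measure.
Proof.
move=> F mF tF mUF; apply: (@measure_semi_sigma_additive _ generated) => //.
  by move=> n; exact: measurable_generated.
exact: measurable_generated.
Qed.

HB.instance Definition _ := isMeasure.Build _ _ _ mean_measure
  mean_measure0 mean_measure_ge0 mean_measure_sigma_additive.

Lemma mean_measureE A : local A -> mean_measure A = (p A)%:E.
Proof.
by move=> lA; rewrite /mean_measure /measure_extension /= measurable_mu_extE.
Qed.

Let mean_measureT : mean_measure setT = 1%E.
Proof.
by rewrite mean_measureE ?pT // -setC0; apply: localC; exact: local0.
Qed.

HB.instance Definition _ :=
  Measure_isProbability.Build _ _ _ mean_measure mean_measureT.

(** The mean [p] is defined on all sets but need not be countably additive on
    measurable ones, which is why [mu] agrees with it on local events only. *)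
Lemma mean_extension : exists mu : probability (configT d) R,
  forall A, local A -> mu A = (p A)%:E.
Proof. by exists mean_measure; exact: mean_measureE. Qed.

End Extension.

(** * The DLR equations from their local form *)

Section Invariance.
Context (R : realType) (d : nat) (gamma : specification R d).
Variable mu : probability (configT d) R.
Local Open Scope ereal_scope.

Lemma measurable_spec (L : {fset site d}) (A : set (config d)) :
  measurable (A : set (configT d)) ->
  measurable_fun [set: configT d] ((gamma L)^~ A : configT d -> \bar R).
Proof.
move=> mA _ Y mY; rewrite setTI; apply: (@measurable_configOn _ (~` [set` L])).
by rewrite -[X in measurable X]setTI; apply: (measurable_kernel (gamma L) A mA).
Qed.

(** The measure [mu gamma_L], the law of the configuration after the spins in
    [L] have been resampled. *)
Definition averaged (L : {fset site d}) (A : set (configT d)) : \bar R :=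
  \int[mu]_x gamma L x A.

Section AveragedMeasure.
Variable L : {fset site d}.

Let averaged0 : averaged L set0 = 0.
Proof.
by rewrite /averaged (eq_integral (cst 0)) ?integral0 // => y _; rewrite measure0.
Qed.

Let averaged_ge0 A : 0 <= averaged L A. Proof. exact: integral_ge0. Qed.

Let averaged_sigma_additive : semi_sigma_additive (averaged L).
Proof.
move=> F mF tF mUF; rewrite [X in _ --> X](_ : _ =
    \int[mu]_x (\sum_(n <oo) gamma L x (F n))); last first.
  apply: eq_integral => x _; apply/esym/cvg_lim => //.
  exact/measure_semi_sigma_additive.
apply/cvg_closeP; split.
  by apply: is_cvg_nneseries => n _ _; exact: integral_ge0.
rewrite closeE// integral_nneseries// => n.
exact: measurable_spec.
Qed.

HB.instance Definition _ := isMeasure.Build _ _ _ (averaged L)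
  averaged0 averaged_ge0 averaged_sigma_additive.

Lemma averaged_eq : (forall A, local A -> averaged L A = mu A) ->
  forall A : set (configT d), measurable A -> averaged L A = mu A.
Proof.
move=> H A mA; apply: (@measure_unique _ R (configT d) (@local d) (fun=> setT)) => //.
- rewrite eqEsubset; split.
    apply: sub_sigma_algebra2 => _ [i _ [B _ <-]].
    by exists [fset i]%fset => xi eta e /=; rewrite e // inE.
  by apply: smallest_sub => //; [exact: sigma_algebra_measurable|exact: measurable_local].
- move=> B C lB lC; rewrite -[B `&` C]setCK setCI; apply: localC.
  by apply: localU; exact: localC.
- by move=> _; rewrite -setC0; apply: localC; exact: local0.
- by rewrite bigcup_const.
- by move=> _; rewrite /= H ?probability_setT ?ltry // -setC0; apply: localC; exact: local0.
Qed.

End AveragedMeasure.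

(** An event outside [L] has probability 0 or 1 under [gamma L x] by properness,
    hence can be taken out of the kernel. *)
Lemma spec_inside L (A B : set (config d)) x :
  measurable (A : set (configT d)) -> measurable (B : set (configC L)) ->
  gamma L x (A `&` B) = (\1_B x)%:E * gamma L x A.
Proof.
move=> mA mB; have mB' := measurable_configOn mB.
have out (C : set (config d)) : measurable (C : set (configC L)) -> ~ C x ->
    gamma L x (A `&` C) = 0.
  move=> mC nCx; have mC' := measurable_configOn mC.
  apply/eqP; rewrite -measure_le0 -[X in _ <= X](_ : gamma L x C = 0).
    by apply: le_measure; rewrite ?inE //; exact: measurableI.
  by rewrite spec_proper // indicE memNset.
have [Bx|nBx] := pselect (B x); last first.
  by rewrite out // indicE memNset // mul0e.
rewrite indicE mem_set // mul1e.
have := @measure_semi_additive2 _ _ _ (gamma L x) (A `&` B) (A `&` ~` B).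
rewrite -setIUr setUv setIT => ->.
- by rewrite [X in _ + X]out ?adde0 //; exact: measurableC.
- exact: measurableI.
- by apply: measurableI => //; exact: measurableC.
- by [].
- by rewrite setIACA setICr setI0.
Qed.

(** If [mu gamma_L = mu] then the integral of [gamma L ^~ A] over an event [B]
    outside [L] is that of [gamma L ^~ (A `&` B)], that is [mu (A `&` B)]: the
    kernel itself is a version of the conditional probability. *)
Lemma admitted_local :
  (forall L A, local A -> averaged L A = mu A) -> admitted gamma mu.
Proof.
move=> H L A mA; exists (gamma L ^~ A); last by apply: aeW.
split.
- exact: (measurable_kernel (gamma L) A mA).
- apply: (@le_integrable _ _ _ mu _ measurableT _ (cst 1)).
  + exact: measurable_spec.
  + move=> x _; rewrite gee0_abs // /cst abse1.
    rewrite -(prob_kernel (s := gamma L) x).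
    by apply: le_measure; rewrite ?inE.
  + exact: finite_measure_integrable_cst.
- move=> B mB; have mB' := measurable_configOn mB.
  rewrite -(averaged_eq (H L)); last exact: measurableI.
  rewrite integral_mkcond /averaged; apply: eq_integral => x _.
  rewrite spec_inside // patchE indicE.
  by case: ifPn; rewrite ?mul1e ?mul0e.
Qed.

End Invariance.

(** * Thermodynamic limits *)

Lemma ultra_cvg (R : realType) (T : Type) (U : set_system T) (f : T -> R) a b :
  UltraFilter U -> (forall x, a <= f x <= b) -> cvg (f @ U).
Proof.
move=> UU fab; have PU : ProperFilter U by exact: ultra_proper.
have Uab : (f @ U) `[a, b]%classic.
  by apply: (@filterS _ U _ setT _ _ filterT) => x _ /=; rewrite in_itv /=.
have [l [_ cl]] := @segment_compact R a b (f @ U) _ Uab.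
apply/cvg_ex; exists l => V lV.
have [//|UnV] := in_ultra_setVsetC (f @^-1` V) UU.
by have [y [/= nVy Vy]] := cl (~` V) V UnV lV.
Qed.

(** Convergence along such an ultrafilter is a generalized limit for volumes
    growing to the whole lattice. *)
Lemma exists_volume_ultrafilter (K : choiceType) :
  exists U : set_system {fset K}, UltraFilter U /\
    forall D : {fset K}, U [set L | (D `<=` L)%fset].
Proof.
pose F := filter_from [set: {fset K}] (fun D => [set L | (D `<=` L)%fset]).
have FF : ProperFilter F.
  apply: filter_from_proper; last by move=> D _; exists D => /=.
  apply: filter_from_filter; first by exists fset0.
  move=> D E _ _; exists (D `|` E)%fset => // L /=.
  by rewrite fsubUset => /andP[].
have [U [UU FU]] := ultraFilterLemma FF.
by exists U; split=> // D; apply: FU; exists D.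
Qed.

Section ThermodynamicLimit.
Context (R : realType) (d : nat) (lambda h : R).
Implicit Types (D L M : {fset site d}) (eta xi : config d) (A : set (config d)).

Local Notation pr := (hc_pr lambda h).

Lemma hc_pr_consistent D L eta A : (D `<=` L)%fset ->
  measurable (A : set (configT d)) ->
  \sum_(w : {ffun L -> spin}) hc_prob lambda h eta w * pr D (glue w eta) A =
  pr L eta A.
Proof.
move=> DL mA; have := hc_consistent lambda h eta DL mA.
rewrite [LHS]hc_integral //; last first.
  exact: (@measurable_spec _ _ (hc_spec d lambda h)).
under eq_bigr do rewrite -[hc_kernel _ _ _ _]/((pr D _ A)%:E) -EFinM.
by rewrite sumEFin => -[].
Qed.

(** The conditional probability of a local event, as a function of the boundary
    condition, depends on the spins near [D] and on those the event depends
    on: the specification is of finite range. *)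
Lemma hc_pr_local D A : local A -> exists M, forall xi eta,
  (forall i, i \in M -> xi i = eta i) -> pr D xi A = pr D eta A.
Proof.
move=> [N AN]; exists (hc_support D `|` N)%fset => xi eta e.
have g (v : {ffun D -> spin}) i : i \in (hc_support D `|` N)%fset ->
    glue v xi i = glue v eta i.
  move=> iM; have [iD|iD] := boolP (i \in D); first by rewrite !(glue_inE _ _ iD).
  by rewrite !glue_out // e.
have gw (v : {ffun D -> spin}) :
    hc_weight lambda h D (glue v xi) = hc_weight lambda h D (glue v eta).
  by apply: hc_weight_ext => i iS; rewrite g // inE iS.
have gA (v : {ffun D -> spin}) : \1_A (glue v xi) = \1_A (glue v eta) :> R.
  rewrite !indicE; congr (nat_of_bool _)%:R; apply/idP/idP; rewrite !inE;
  by apply: AN => i iN; rewrite g // inE iN orbT.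
apply: eq_bigr => v _; rewrite gA /hc_prob gw; congr (_ / _ * _).
by apply: eq_bigr => v' _; rewrite gw.
Qed.

Definition pattern M (v : {ffun M -> spin}) : set (config d) :=
  [set xi | restr M xi = v].

Lemma pattern_local M v : local (@pattern M v).
Proof.
exists M => xi eta e; rewrite /pattern /= => <-.
by apply/ffunP => i; rewrite !ffunE e // (valP i).
Qed.

Lemma pattern_decomposition M (f : config d -> R) xi :
  (forall xi eta, (forall i, i \in M -> xi i = eta i) -> f xi = f eta) ->
  f xi = \sum_(v : {ffun M -> spin}) f (glue v (fun=> spin0)) * \1_(pattern v) xi.
Proof.
move=> fM; rewrite (bigD1 (restr M xi)) //= big1 ?addr0 => [|v vx].
  rewrite indicE mem_set // mulr1; apply: fM => i iM.
  by rewrite (glue_inE _ _ iM) ffunE.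
by rewrite indicE memNset ?mulr0 // /pattern /= => /esym; exact/eqP.
Qed.

(** Every boundary condition has a Gibbs measure as limit point, for which
    bounds on local events that are uniform in the volume are inherited. By
    [pattern_decomposition] both sides of the finite-volume consistency relation
    are finite combinations of probabilities of local events, hence converge. *)
Lemma thermodynamic_limit eta : exists mu : probability (configT d) R,
  Gibbs (hc_spec d lambda h) mu /\
  forall A c, local A -> (forall L, pr L eta A <= c) -> (mu A <= c%:E)%E.
Proof.
have [U [UU Ufset]] := exists_volume_ultrafilter (site d).
have PU : ProperFilter U by exact: ultra_proper.
pose f A L := pr L eta A.
pose p A := lim (f A @ U).
have cf A : cvg (f A @ U).
  apply: (@ultra_cvg R _ U (f A) 0 1 UU) => L.
  by rewrite hc_pr_ge0 hc_pr_le1.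
have p_ge0 A : 0 <= p A.
  by apply: (limr_ge (cf A)); apply: (filterE PU) => L; exact: hc_pr_ge0.
have pT : p setT = 1.
  rewrite /p (_ : f setT = cst 1) ?lim_cst //.
  by apply/funext => L; rewrite /f hc_prT.
have pU A B : A `&` B = set0 -> p (A `|` B) = p A + p B.
  move=> AB; rewrite /p (_ : f (A `|` B) = f A + f B); first exact: limD.
  by apply/funext => L; rewrite /f hc_prU.
have [mu muE] := mean_extension p_ge0 pT pU.
exists mu; split; last first.
  move=> A c lA prc; rewrite muE // lee_fin; apply: (limr_le (cf A)).
  by apply: (filterE PU) => L; exact: prc.
apply: admitted_local => D A lA.
have [M DM] := hc_pr_local D lA.
pose phi (v : {ffun M -> spin}) := pr D (glue v (fun=> spin0)) A.
have phiE xi := @pattern_decomposition M (fun xi => pr D xi A) xi DM.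
transitivity (\sum_(v : {ffun M -> spin}) (phi v)%:E * mu (pattern v))%E.
  rewrite /averaged.
  transitivity (\int[mu]_x (\sum_(v : {ffun M -> spin})
      (phi v)%:E * (\1_(pattern v) x)%:E))%E.
    apply: eq_integral => x _; rewrite -[LHS]/((pr D x A)%:E) phiE -sumEFin.
    by apply: eq_bigr => v _; rewrite EFinM.
  have mp (v : {ffun M -> spin}) : measurable (pattern v : set (configT d)).
    by apply: measurable_local; exact: pattern_local.
  have mi (v : {ffun M -> spin}) : measurable_fun [set: configT d]
      ((fun x => (\1_(pattern v) x)%:E) : configT d -> \bar R).
    by apply/measurable_EFinP; exact: measurable_indic.
  rewrite ge0_integral_sum //.
  - apply: eq_bigr => v _; rewrite ge0_integralZl ?lee_fin ?hc_pr_ge0 //.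
    by rewrite integral_indic // setIT.
  - by move=> v; exact: measurable_funeM.
  - by move=> v x _; rewrite mule_ge0 // lee_fin ?hc_pr_ge0.
rewrite muE //.
under eq_bigr => v _ do rewrite (muE _ (pattern_local v)) -EFinM.
rewrite sumEFin; congr EFin.
have lim_sum : (fun L => \sum_(v : {ffun M -> spin}) phi v * f (pattern v) L) @ U -->
    \sum_(v : {ffun M -> spin}) phi v * p (pattern v).
  apply: cvg_big => [|v _]; first exact: add_continuous.
  by apply: cvgMl_tmp; exact: cf.
apply: (cvg_unique _ lim_sum) => //.
apply: cvg_trans (cf A); apply: near_eq_cvg.
apply: filterS (Ufset D) => L /= DL; rewrite /f.
rewrite -(hc_pr_consistent eta DL (measurable_local lA)).
transitivity (\sum_(w : {ffun L -> spin}) \sum_(v : {ffun M -> spin})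
    hc_prob lambda h eta w * (phi v * \1_(pattern v) (glue w eta))).
  by apply: eq_bigr => w _; rewrite -mulr_sumr; congr (_ * _); exact: phiE.
rewrite exchange_big /=; apply: eq_bigr => v _; rewrite [RHS]mulr_sumr.
by apply: eq_bigr => w _; rewrite mulrCA.
Qed.

End ThermodynamicLimit.

(** * Phase transition *)

(** The event that the spin at the origin differs from +1 has probability at most
    1/3 under the limit with boundary spin +1. Under the limit with boundary
    spin -1 it has probability at least 2/3, since it is implied by the spin
    being -1. *)
Theorem corollary2p3 (R : realType) (d : nat) (hd : (2 <= d)%N) :
  exists2 lambda_c : R, 0 < lambda_c &
    forall lambda : R, lambda_c <= lambda ->
      phase_transition (hc_spec d lambda 0).
Proof.
case: d hd => [|[|d]] // _.
pose lambda_c : R := 12 * (3 ^ (3 ^ d.+2))%:R.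
have lambda_c_gt0 : 0 < lambda_c by rewrite mulr_gt0 // ltr0n expn_gt0.
exists lambda_c => // lambda large.
have lambda_gt0 := lt_le_trans lambda_c_gt0 large.
pose plus : spin := @SeqSub _ [:: -1; 0; 1 : int] 1 isT.
pose minus : spin := @SeqSub _ [:: -1; 0; 1 : int] (-1) isT.
have lw s : local [set xi : config d.+2 | xi 0 != s].
  by exists [fset 0]%fset => xi eta e /=; rewrite e // inE.
have [mu [Gmu mu_le]] := thermodynamic_limit lambda 0 (fun _ : site d.+2 => plus).
have [nu [Gnu nu_le]] := thermodynamic_limit lambda 0 (fun _ : site d.+2 => minus).
have mu3 := mu_le _ _ (lw plus)
  (fun L => @hc_pr_wrong_spin _ _ _ lambda_gt0 L plus isT large).
have nu3 := nu_le _ _ (lw minus)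
  (fun L => @hc_pr_wrong_spin _ _ _ lambda_gt0 L minus isT large).
exists mu, nu; split => //; exists [set xi | xi 0 != plus].
  exact: measurable_local.
move=> E.
pose A s : set (configT d.+2) := [set xi | xi 0 != s].
have mA s : measurable (A s) by apply: measurable_local; exact: lw.
have AT : A plus `|` A minus = setT.
  apply/seteqP; split=> // xi _; rewrite /A /=.
  by have [->|x0] := eqVneq (xi 0) plus; [right|left]; rewrite ?x0.
have le1 : (1 <= nu (A plus) + nu (A minus))%E.
  by rewrite -(probability_setT nu) -AT; exact: measureU2.
have le2 : (nu (A plus) + nu (A minus) <= (3^-1)%:E + (3^-1)%:E)%E.
  by apply: leeD => //; rewrite -E.
by have := le_trans le1 le2; rewrite -EFinD lee_fin; lra.
Qed.
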